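(* Let $a,b,c$ be three distinct positive integers with $a<c$ and $b<c$, and let $S=\{a,b,c\}$. Then $S$ forces discrepancy two if and only if $a+b=c$ and $\nu_2(a)\neq\nu_2(b)$. Moreover, in that case the skip graph $G(S)$ contains a cycle of length $3$ but contains no odd cycle of any other length.
   Context: $\nu_2(n)$ denotes the exponent of $2$ in the prime factorization of the positive integer $n$. A finite set $S$ of positive integers forces discrepancy two if for every sequence $(x_n)_{n\ge1}$ with $x_n\in\{+1,-1\}$ there exist $s\in S$ and an integer $k\ge1$ with $\left|\sum_{i=1}^k x_{is}\right|>1$. The skip graph $G(S)$ is the simple graph with vertex set $\mathbb{N}=\{0,1,2,\dots\}$ in which, for each $s\in S$ and each integer $j\ge 0$, the vertices $2js$ and $(2j+1)s$ are joined by an edge (called an $s$-arc). A cycle means a graph cycle (length at least 3, distinct vertices); an odd cycle is a cycle of odd length. *)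

(* Defs.v *)
From HB Require Import structures.
From mathcomp Require Import all_boot all_order all_algebra finmap boolp.

Set Implicit Arguments.
Unset Strict Implicit.
Unset Printing Implicit Defensive.

Import Order.TTheory GRing.Theory Num.Theory.

(* Throughout, the elements of [S] are meant to be positive. Sequences are
   indexed from 1: the value [x 0] is unconstrained and never used. *)
Definition forces_discrepancy_two (S : {fset nat}) : Prop :=
  forall x : nat -> int,
    (forall n : nat, 0 < n -> x n = 1%R \/ x n = (-1)%R) ->
    exists s k : nat,
      [/\ s \in S, 0 < k & (1 < `|\sum_(1 <= i < k.+1) x (i * s)%N|)%R].

Definition skip_arc (s u v : nat) : Prop :=
  exists j : nat, u = 2 * j * s /\ v = (2 * j + 1) * s.

(* The edge relation of the skip graph on the vertex set [nat], made boolean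
   classically so that [ucycle] applies to it. *)
Definition skip_graph (S : {fset nat}) : rel nat :=
  fun u v => `[< exists2 s, s \in S & skip_arc s u v \/ skip_arc s v u >].

(* [ucycle] alone also accepts sequences of size 0, and of size 2 whose two
   vertices are adjacent. *)
Definition graph_cycle (e : rel nat) (p : seq nat) : Prop :=
  ucycle e p /\ 3 <= size p.

(* Main.v *)
(* Joining [2js] and [(2j+1)s] for all integers [j] extends the skip graph to the
   integers. The extended graph is invariant under translation by [2abc], and
   the map [n |-> -n] embeds in it the graph of pairs [(2j+1)s, (2j+2)s] whose
   2-colourings are exactly the sequences of discrepancy at most one.

   For [a < b < c], consecutive arcs of an odd cycle have different lengths, and
   a pattern [x y x] of lengths forces [x] to be a proper divisor of [y], as the
   ends of the [y]-arc are multiples of [x]. So [bab], [cac], [cbc] do not occur,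
   and divisibility by [c] and by [b] respectively excludes [aba] and [bcb]. A
   cyclic word in which [abc] may change direction through [aca] but not back
   keeps its direction, so the word is periodic, [abcabc...] or its reverse.
   Three consecutive arcs [x y c] between multiples of [c] then give
   [c | x +- y], hence [x + y = c] with equal signs; after division by
   [gcd x y] the parities exclude [x] and [y] both odd, and otherwise close the
   walk after three steps. *)
Require Import Defs.
From HB Require Import structures.
From mathcomp Require Import all_boot all_order all_algebra finmap boolp.
From mathcomp Require Import zify ring.

Set Implicit Arguments.
Unset Strict Implicit.
Unset Printing Implicit Defensive.

Import Order.TTheory GRing.Theory Num.Theory.

(** * Arcs over the integers, and three consecutive arcs *)

Definition int_arc (s u v : int) : Prop :=
  exists j : int, u = (2 * j * s)%R /\ v = ((2 * j + 1) * s)%R.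

Definition int_adj (s u v : int) : Prop := int_arc s u v \/ int_arc s v u.

(** Keeps only what is linear in the unknowns, for [lia]: with [s] positive, a step up starts at an
    even integer and a step down ends at one. *)
Lemma int_adj_parity s u v : int_adj s u v ->
  exists p : int, (u = 2 * p /\ v = 2 * p + s \/ v = 2 * p /\ u = 2 * p + s)%R.
Proof. by case=> -[j [-> ->]]; exists (j * s)%R; [left|right]; split; ring. Qed.

Lemma int_adj_dvd s u v : int_adj s u v -> exists i j : int, (u = i * s /\ v = j * s)%R.
Proof. by case=> -[j [-> ->]]; do 2 eexists; split; reflexivity. Qed.

Lemma int_adj_scale g s u v : g != 0%R ->
  int_adj (g * s) (g * u) (g * v) <-> int_adj s u v.
Proof.
move=> g0; split; case=> -[j [e1 e2]]; [left|right|left|right]; exists j; split.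
1-4: apply: (mulfI g0); rewrite ?e1 ?e2; ring.
all: rewrite ?e1 ?e2; ring.
Qed.

Lemma small_multiple (z k d : int) : (0 < z)%R -> (d = k * z)%R ->
  (`|d| < 2 * z)%R -> d = 0%R \/ d = z \/ d = (- z)%R.
Proof.
move=> z0 -> lt.
have [->|[->|->]] : (k = 0 \/ k = 1 \/ k = -1)%R by nia.
1-3: lia.
Qed.

(** The steps of lengths [x] and [y] have the same sign, as they add up to [z] or [-z]. Both start
    at even vertices if they go up, and both end at even vertices if they go down, so [x] or [y] is
    even; the other is then odd, and so is [z]. The parity of [v2] now sends the last [z]-arc back
    to [v0]. *)
Lemma triple_step_parity (x y z w v0 v1 v2 v3 : int) :
  (x + y = z)%R -> (v2 - v0 = z \/ v2 - v0 = -z)%R -> (0 < x)%R -> (0 < y)%R ->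
  ~ (exists i j, x = 2 * i /\ y = 2 * j)%R ->
  int_adj z w v0 -> int_adj x v0 v1 -> int_adj y v1 v2 -> int_adj z v2 v3 ->
  v3 = v0 /\ (exists i, x + y = 2 * i + 1)%R.
Proof.
move=> exyz ev x0 y0 nev /int_adj_parity[p0 e0] /int_adj_parity[p1 e1].
move=> /int_adj_parity[p2 e2] /int_adj_parity[p3 e3].
have [[i [j [ex ey]]]|[i [j [ex ey]]]|[i [j [ex ey]]]] :
  [\/ exists i j, x = 2 * i + 1 /\ y = 2 * j, exists i j, x = 2 * i /\ y = 2 * j + 1
    | exists i j, x = 2 * i + 1 /\ y = 2 * j + 1]%R.
- have [i ei] : exists i, (x = 2 * i \/ x = 2 * i + 1)%R by exists (x %/ 2)%Z; lia.
  have [j ej] : exists i, (y = 2 * i \/ y = 2 * i + 1)%R by exists (y %/ 2)%Z; lia.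
  case: ei ej => ei [] ej.
  + by case: nev; exists i, j.
  + by constructor 2; exists i, j.
  + by constructor 1; exists i, j.
  + by constructor 3; exists i, j.
- split; [lia|exists (i + j)%R; lia].
- split; [lia|exists (i + j)%R; lia].
- lia.
Qed.

Lemma int_adj_sym s u v : int_adj s u v -> int_adj s v u.
Proof. by case; [right|left]. Qed.

Lemma int_adj_dist s u v : (0 < s)%R -> int_adj s u v -> (`|v - u| = s)%R.
Proof. move=> s0 /int_adj_parity[p]; lia. Qed.

Lemma int_adj_even s q u v : (0 < s)%R -> u = (2 * q * s)%R -> int_adj s u v ->
  v = (u + s)%R.
Proof.
move=> s0 eu; case=> -[j [e1 e2]]; first by rewrite e1 e2; ring.
by exfalso; have : (2 * q - (2 * j + 1) = 0)%R by [apply: (mulIf (x := s)); lia]; lia.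
Qed.

Lemma int_adj_odd s q u v : (0 < s)%R -> u = ((2 * q + 1) * s)%R -> int_adj s u v ->
  v = (u - s)%R.
Proof.
move=> s0 eu; case=> -[j [e1 e2]]; last by rewrite e1 e2; ring.
by exfalso; have : (2 * j - (2 * q + 1) = 0)%R by [apply: (mulIf (x := s)); lia]; lia.
Qed.

(** The arc leads up at even multiples of [s] and down at odd ones, so the [s]-arcs form a
    matching. *)
Lemma int_adj_inj s u v w : (0 < s)%R -> int_adj s u v -> int_adj s v w -> w = u.
Proof.
move=> s0 [] [j [e1 e2]].
- by move=> /(int_adj_odd s0 e2) ->; rewrite e1 e2; ring.
- by move=> /(int_adj_even s0 e1) ->; rewrite e1 e2; ring.
Qed.

(** For positive [x] and [y] this says that their 2-adic valuations differ, in a form that suits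
    integers and linear arithmetic. *)
Definition opposite_ratio_parity (x y : int) : Prop :=
  exists g x' y' i : int,
    [/\ (0 < g)%R, x = (g * x')%R, y = (g * y')%R & (x' + y' = 2 * i + 1)%R].

(** Both [v0] and [v2] are ends of [z]-arcs, so [z] divides [v2 - v0], which is less than [2 * z] in
    absolute value and nonzero because [x] and [y] differ. Division by the gcd of [x] and [y]
    reduces the rest to [triple_step_parity]. *)
Lemma triple_step (x y z w v0 v1 v2 v3 : int) :
  (0 < x)%R -> (0 < y)%R -> (x < z)%R -> (y < z)%R -> x <> y ->
  int_adj z w v0 -> int_adj x v0 v1 -> int_adj y v1 v2 -> int_adj z v2 v3 ->
  [/\ (x + y = z)%R, v3 = v0 & opposite_ratio_parity x y].
Proof.
move=> x0 y0 xz yz nxy zw x01 y12 z23.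
have [i0 [j0 [ew e0]]] := int_adj_dvd zw.
have [i2 [j2 [e2 e3]]] := int_adj_dvd z23.
have d01 := int_adj_dist x0 x01; have d12 := int_adj_dist y0 y12.
have [||||evz] := @small_multiple z (i2 - j0) (v2 - v0); [lia|rewrite e0 e2; ring|lia|lia|].
have exyz : (x + y = z)%R by lia.
have [g [x' [y' [g0 [ex ey nev]]]]] : exists g x' y', (0 < g)%R /\
    [/\ x = g * x', y = g * y' & ~ exists i j, x' = 2 * i /\ y' = 2 * j]%R.
  exists (gcdz x y), (x %/ gcdz x y)%Z, (y %/ gcdz x y)%Z.
  have g0 : (0 < gcdz x y)%R by rewrite lt0r gcdz_eq0 andbT; lia.
  split=> //; rewrite ![(gcdz x y * _)%R]mulrC !divzK ?dvdz_gcdl ?dvdz_gcdr //; split=> //.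
  (* If both quotients were even, Bezout would make the gcd an even multiple of itself. *)
  case=> i [j [ei ej]]; have [u [t]] := Bezoutz x y.
  rewrite -{1}[y](divzK (dvdz_gcdr x y)) -{1}[x](divzK (dvdz_gcdl x y)) ei ej => E.
  have : (2 * (u * i + t * j) - 1 = 0)%R.
    by apply: (mulIf (x := gcdz x y)); [lia|move: E; move: (gcdz x y) => h; lia].
  by lia.
have [m0 [m1 [f0 f1]]] := int_adj_dvd x01.
move: ew e0 e2 e3; rewrite -exyz ex ey => ew e0 e2 e3.
have hs u v s : int_adj (g * s)%R (g * u)%R (g * v)%R -> int_adj s u v.
  by move=> h; apply/(@int_adj_scale g) => //; lia.
(* All vertices are multiples of [g]: [v1] as a multiple of [x], the others as multiples of [z]. *)
have [V0 E0] : exists V, v0 = (g * V)%R by eexists; rewrite e0 -mulrDr mulrCA.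
have [V2 E2] : exists V, v2 = (g * V)%R by eexists; rewrite e2 -mulrDr mulrCA.
have [V3 E3] : exists V, v3 = (g * V)%R by eexists; rewrite e3 -mulrDr mulrCA.
have [W Ew] : exists V, w = (g * V)%R by eexists; rewrite ew -mulrDr mulrCA.
have [V1 E1] : exists V, v1 = (g * V)%R by eexists; rewrite f1 ex mulrCA.
move: zw x01 y12 z23; rewrite -exyz ex ey -mulrDr E0 E1 E2 E3 Ew.
move=> /hs zw /hs x01 /hs y12 /hs z23.
have x'0 : (0 < x')%R by rewrite -(pmulr_rgt0 _ g0) -ex.
have y'0 : (0 < y')%R by rewrite -(pmulr_rgt0 _ g0) -ey.
have evz' : (V2 - V0 = x' + y' \/ V2 - V0 = - (x' + y'))%R.
  by case: evz => h; [left|right]; apply: (mulfI (x := g)); move: h; rewrite -exyz ex ey E0 E2; lia.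
have [-> [i ei]] := triple_step_parity erefl evz' x'0 y'0 nev zw x01 y12 z23.
by split=> //; exists g, x', y', i.
Qed.

(** * Odd closed walks with three arc lengths *)

(* [b] is a multiple [m * a] of [a], so the end of the [b]-arc that is an even
   multiple of [b] is an even multiple of [a]; this fixes the direction of the
   [a]-arc there. *)
Lemma no_aba_arc (a b c m v1 v2 v3 v4 k1 k4 : int) :
  (0 < a)%R -> (a < b)%R -> (b < c)%R -> b = (m * a)%R -> (2 <= m)%R ->
  int_adj a v1 v2 -> int_arc b v2 v3 -> int_adj a v3 v4 ->
  v1 = (k1 * c)%R -> v4 = (k4 * c)%R -> False.
Proof.
move=> a0 ab bc eb m2 a12 [j [e2 e3]] a34 e1 e4.
have ev1 := int_adj_even (q := (j * m)%R) a0 _ (int_adj_sym a12).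
have d34 := int_adj_dist a0 a34.
have le2 : (2 * a <= b)%R by rewrite eb ler_pM2r.
have {}ev1 : v1 = (v2 + a)%R by apply: ev1; rewrite e2 eb; ring.
have e23 : v3 = (v2 + b)%R by rewrite e2 e3; ring.
(* The difference is [b] or [b - 2 * a], below [c] in absolute value, so it vanishes and
   [b = 2 * a]. Then [v3] is an even multiple of [a] too, both ends move up by [a], and the
   difference is [b] after all. *)
have [|||d0|d0] := @small_multiple c (k4 - k1) (v4 - v1); [lia|rewrite e1 e4; ring|lia| |lia].
have eb2 : (b = 2 * a)%R by lia.
have : v4 = (v3 + a)%R.
  by apply: (int_adj_even (q := (2 * j + 1)%R) a0 _ a34); rewrite e3 eb2; ring.
lia.
Qed.

Lemma no_aba (a b c m v1 v2 v3 v4 k1 k4 : int) :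
  (0 < a)%R -> (a < b)%R -> (b < c)%R -> b = (m * a)%R -> (2 <= m)%R ->
  int_adj a v1 v2 -> int_adj b v2 v3 -> int_adj a v3 v4 ->
  v1 = (k1 * c)%R -> v4 = (k4 * c)%R -> False.
Proof.
move=> a0 ab bc eb m2 a12 [b23|b32] a34 e1 e4.
  exact: (no_aba_arc a0 ab bc eb m2 a12 b23 a34 e1 e4).
exact: (no_aba_arc a0 ab bc eb m2 (int_adj_sym a34) b32 (int_adj_sym a12) e4 e1).
Qed.

Lemma cyclic_word (T : Type) (s : nat -> T) (x y z : T) :
  (forall i, s i = x -> s i.+1 = y) -> (forall i, s i = y -> s i.+1 = z) ->
  (forall i, s i = z -> s i.+1 = x) -> s 0 = x \/ s 0 = y \/ s 0 = z ->
  exists l, [/\ s l = z, s l.+1 = x, s l.+2 = y & s l.+3 = z].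
Proof.
move=> xy yz zx s0.
have [l sl] : exists l, s l = z.
  by case: s0 => [/xy/yz|[/yz|]] h; [exists 2|exists 1|exists 0].
have s1 := zx _ sl; have s2 := xy _ s1.
by exists l; split=> //; apply: yz.
Qed.

(** A closed walk is given as a periodic sequence, so that no index wraps around; absence of
    backtracking replaces distinctness of the vertices. *)
Lemma odd_walk_triangle (a b c : int) (v : nat -> int) (k : nat) :
  (0 < a)%R -> (a < b)%R -> (b < c)%R -> odd k ->
  (forall i, v (i + k) = v i) -> (forall i, v i.+2 <> v i) ->
  (forall i, exists2 s, s \in [:: a; b; c] & int_adj s (v i) (v i.+1)) ->
  [/\ (a + b = c)%R, opposite_ratio_parity a b & exists i, v i.+3 = v i].
Proof.
move=> a0 ab bc ok vk nb adj.
(* Arc lengths are read off as distances, so [s] inherits the period of [v]. *)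
pose s i := `|v i.+1 - v i|%R.
have sk i : s (i + k) = s i by rewrite /s -addSn !vk.
have sP i : (s i = a \/ s i = b \/ s i = c) /\ int_adj (s i) (v i) (v i.+1).
  have [x] := adj i; rewrite !inE => /or3P xS xa.
  have x0 : (0 < x)%R by case: xS => /eqP ->; lia.
  rewrite /s (int_adj_dist x0 xa); split=> //.
  by case: xS => /eqP ->; auto.
have s0 i : (0 < s i)%R by have [] := sP i; lia.
have sN i : s i.+1 <> s i.
  move=> e; apply: (nb i); have [_ h] := sP i; have [_] := sP i.+1; rewrite e.
  exact: int_adj_inj (s0 i) h.
have dv i : exists p q, v i = (p * s i)%R /\ v i.+1 = (q * s i)%R.
  exact: int_adj_dvd (sP i).2.
have xyx i : s i.+2 = s i -> exists2 m, s i.+1 = (m * s i)%R & (2 <= m)%R.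
  move=> e; have [_ [q [_ e1]]] := dv i; have [p [_ [e2 _]]] := dv i.+2.
  have h : s i.+1 = (`|p - q| * s i)%R.
    by rewrite {1}/s e2 e1 e -mulrBl normrM (gtr0_norm (s0 i)).
  exists `|p - q|%R => //; have := sN i; have := s0 i.+1; rewrite h.
  by have := s0 i; case: (`|p - q|%R) => [[|[|n]]|n] //; lia.
have xyx_lt i : s i.+2 = s i -> (s i < s i.+1)%R.
  by move=> /xyx[m -> m2]; have := s0 i; nia.
have naba i : ~ [/\ s i.+1 = a, s i.+2 = b & s i.+3 = a].
  move=> [e1 e2 e3].
  (* A neighbouring [b] would create [bab], so both neighbours of the pattern are [c], and its two
     ends are multiples of [c]. *)
  have ec : s i = c.
    have := sN i; have := @xyx_lt i; have := (sP i).1; rewrite e1 e2; lia.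
  have ec' : s i.+4 = c.
    have := sN i.+3; have := @xyx_lt i.+2; have := (sP i.+4).1; rewrite e2 e3; lia.
  have [|m em m2] := @xyx i.+1; first by rewrite e1 e3.
  have [_ [k1 [_ E1]]] := dv i; have [k4 [_ [E4 _]]] := dv i.+4.
  have := (sP i.+1).2; have := (sP i.+2).2; have := (sP i.+3).2.
  rewrite e1 e2 in em; rewrite ec in E1; rewrite ec' in E4; rewrite e1 e2 e3 => h3 h2 h1.
  exact: (no_aba a0 ab bc em m2 h1 h2 h3 E1 E4).
(* Without [a] the lengths would alternate between [b] and [c], against the odd period. *)
have [j ej] : exists j, s j = a.
  apply: contrapT => na.
  have {}na i : s i <> a by move=> e; apply: na; exists i.
  have alt i : (s i == s 0) = ~~ odd i.
    elim: i => [|i IH]; first by rewrite eqxx.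
    rewrite /= -IH; have := sN i; have := na i; have := na i.+1; have := na 0.
    have := (sP i).1; have := (sP i.+1).1; have := (sP 0).1; lia.
  by have := alt k; rewrite -[k]add0n sk eqxx /= add0n ok.
(* The pattern makes [b] divide [c]. One neighbour of an [a]-arc is [b] and the other is [c], so
   both of its ends would be multiples of [b], which exceeds [a]. *)
have nbcb i : ~ [/\ s i = b, s i.+1 = c & s i.+2 = b].
  move=> [e1 e2 e3].
  have [|m] := @xyx i; first by rewrite e1 e3.
  rewrite e1 e2 => ec m2.
  have [l el] : exists l, s l.+1 = a.
    (* Going one period further gives the [a]-arc a predecessor. *)
    by exists (j + k.-1); rewrite -addnS prednK ?sk //; case: (k) ok.
  have [p [q [ep eq]]] : exists p q, v l.+1 = (p * b)%R /\ v l.+2 = (q * b)%R.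
    have [_ [q [_ E1]]] := dv l; have [p [_ [E4 _]]] := dv l.+2.
    have := sN l; have := sN l.+1; have := @xyx_lt l; have := (sP l).1; have := (sP l.+2).1.
    rewrite el.
    case=> [|[e|e]]; [lia| |]; case=> [|[e'|e']]; try lia;
      move=> *; rewrite e in E4; rewrite e' in E1.
    - by exists (q * m)%R, p; rewrite -mulrA -ec.
    - by exists q, (p * m)%R; rewrite -mulrA -ec.
  move: el; rewrite /s ep eq -mulrBl normrM.
  by case: (`|q - p|%R) => [[|n]|n]; nia.
(* A change of direction after a forward pair is [aba], [bcb] or [cac], all excluded. Indices start
   at 1 because [naba] looks at the arc before the pattern. *)
pose fwd i := [\/ s i = a /\ s i.+1 = b, s i = b /\ s i.+1 = c | s i = c /\ s i.+1 = a].
have fwdS i : fwd i.+1 -> fwd i.+2.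
  have := sN i.+1; have := sN i.+2; have := (sP i.+3).1; have := naba i; have := nbcb i.+1.
  have := @xyx_lt i.+1.
  move=> lt h1 h2 [e|[e|e]] n1 n2 [] [e1 e2]; rewrite /fwd e e1 e2 in n1 n2 lt h1 h2 *;
    try lia; try by case: h1; try by case: h2.
  - by constructor 3.
  - by constructor 1.
  - by constructor 2.
have [[i f1]|nf] := pselect (exists i, fwd i.+1).
- have f n : fwd (i.+1 + n).
    by elim: n => [|n IH]; rewrite ?addn0 // addnS; apply: fwdS.
  have [||||l] := @cyclic_word _ (fun n => s (i.+1 + n)) a b c.
  1-3: by move=> n e; have := f n; rewrite /fwd e addnS;
          case=> -[e1 e2] //; clear -e1 ab bc; lia.
    exact: (sP _).1.
  rewrite !addnS; move: (i.+1 + l) => {}l -[e0 e1 e2 e3].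
  have := (sP l).2; have := (sP l.+1).2; have := (sP l.+2).2; have := (sP l.+3).2.
  rewrite e0 e1 e2 e3 => h3 h2 h1 h0.
  have [|||||E1 E2 E3] := triple_step _ _ _ _ _ h0 h1 h2 h3; try lia.
  by split=> //; exists l.+1.
- have bwd i : [\/ s i.+1 = a /\ s i.+2 = c, s i.+1 = b /\ s i.+2 = a | s i.+1 = c /\ s i.+2 = b].
    have := sN i.+1; have := (sP i.+1).1; have := (sP i.+2).1.
    move=> [e'|[e'|e']] [e|[e|e]] n; rewrite e e' in n *; first
      [by case: n | by constructor 1 | by constructor 2 | by constructor 3
      | by case: nf; exists i; rewrite /fwd e e';
        first [by constructor 1 | by constructor 2 | by constructor 3]].
  have [||||l [e0 e1 e2 e3]] := @cyclic_word _ (fun n => s n.+1) b a c.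
  1-3: by move=> n e; have := bwd n; rewrite e; case=> -[e1 e2] //; clear -e1 ab bc; lia.
    by case: (bwd 0) => -[->]; auto.
  have := (sP l.+1).2; have := (sP l.+2).2; have := (sP l.+3).2; have := (sP l.+4).2.
  rewrite e0 e1 e2 e3 => h3 h2 h1 h0.
  have [|||||E1 E2 [g [x' [y' [i [g0 ex ey E3]]]]]] := triple_step _ _ _ _ _ h0 h1 h2 h3; try lia.
  split; [lia| |by exists l.+2].
  by exists g, y', x', i; split=> //; lia.
Qed.

(** * Odd closed walks and 2-colourings of arbitrary graphs *)

(** A repeated vertex cuts the closed walk into two shorter ones, and one of these is odd. *)
Lemma odd_cycle_ucycle (T : eqType) (e : rel T) (p : seq T) :
  cycle e p -> odd (size p) -> exists q, ucycle e q /\ odd (size q).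
Proof.
have [n] := ubnP (size p); elim: n => // n IH in p * => le_pn cp op.
have [up|/uniqPn] := boolP (uniq p); first by exists p; rewrite /ucycle cp up.
case: p => // x0 p0 in le_pn cp op *; move: (x0 :: p0) => p in le_pn cp op *.
move=> /(_ x0)[i [j [ltij ltjp eij]]].
have [q1 [q2 [x ep]]] : exists q1 q2 x, perm_eq p (x :: q1 ++ x :: q2)
    /\ cycle e (x :: q1 ++ x :: q2).
  (* Rotation by [i] brings the first occurrence to the front; the second one splits the rest. *)
  exists (drop i.+1 (take j p)), (drop j.+1 p ++ take i p), (nth x0 p i).
  have -> : nth x0 p i :: drop i.+1 (take j p) ++ nth x0 p i :: drop j.+1 p ++ take i p
      = rot i p.
    rewrite /rot -[in drop i p](cat_take_drop j p) drop_cat size_take ltjp ltij.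
    rewrite (drop_nth x0 ltjp) (@drop_nth _ x0 i (take j p)) ?size_take ?ltjp //.
    rewrite (nth_take _ ltij) -eij.
    by rewrite -catA.
  by rewrite rot_cycle perm_sym perm_rot.
case: ep => /perm_size sp; rewrite /= rcons_cat cat_path /= => /and3P[c1 c1' c2].
have s1 : size p = (size q1).+1 + (size q2).+1 by rewrite sp /= size_cat /=; lia.
have [o1|o1] := boolP (odd (size q1).+1).
- apply: (IH (x :: q1)) => //; first by move: le_pn; rewrite s1 /=; lia.
  by rewrite /= rcons_path c1 c1'.
- apply: (IH (x :: q2)); first by move: le_pn; rewrite s1 /=; lia.
  + by [].
  + by move: op; rewrite s1 oddD (negbTE o1).
Qed.

(** The colour is the parity of a walk to a chosen representative of the component; it is well
    defined because closed walks are even. *)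
Lemma bipartite_of_no_odd_cycle (T : choiceType) (e : rel T) : symmetric e ->
  (forall p, ucycle e p -> ~~ odd (size p)) ->
  exists f : T -> bool, forall x y, e x y -> f y = ~~ f x.
Proof.
move=> se noc.
pose walk x y n := exists p, [/\ path e x p, last x p = y & size p = n].
have walk0 x : walk x x 0 by exists [::].
have walkD x y z m n : walk x y m -> walk y z n -> walk x z (m + n).
  move=> [p [pp lp <-]] [q [pq lq <-]]; exists (p ++ q).
  by rewrite cat_path last_cat size_cat lp pp pq lq.
have walk_sym x y n : walk x y n -> walk y x n.
  move=> [p [pp lp <-]]; exists (rev (belast x p)).
  have es : (fun z => e^~ z) =2 e by move=> u w; rewrite se.
  rewrite -lp -(eq_path es) rev_path size_rev size_belast; split=> //.
  by case: (p) => //= y' p'; rewrite rev_cons last_rcons.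
have walk1 x y : e x y -> walk x y 1 by exists [:: y]; rewrite /= andbT.
have even_closed x n : walk x x n -> ~~ odd n.
  move=> [p [pp lp <-]]; apply/negP => op.
  have cp : cycle e p.
    by case: p => // y p in pp lp op *; rewrite (cycle_path x) /= -/(last y p) in lp *; rewrite lp.
  by have [q [/noc/negP]] := odd_cycle_ucycle cp op.
have exr x : exists y, `[< exists n, walk x y n >] by exists x; apply/asboolP; exists 0.
pose r x := xchoose (exr x).
have rP x : exists n, walk x (r x) n by apply/asboolP; exact: xchooseP (exr x).
(* Adjacent vertices reach the same vertices, and [xchoose] gives equal results on extensionally
   equal predicates. *)
have rE x y : e x y -> r x = r y.
  move=> exy; apply: eq_xchoose => z; apply/asboolP/asboolP => -[n w].
  - by exists (1 + n); apply: walkD w; apply/walk_sym/walk1.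
  - by exists (1 + n); apply: walkD w; apply/walk1.
exists (fun x => `[< exists2 n, odd n & walk x (r x) n >]) => x y exy.
have odd_cl m n : walk x (r x) m -> walk y (r y) n -> odd n = ~~ odd m.
  rewrite -(rE _ _ exy) => wm /walk_sym wn.
  have := even_closed _ _ (walkD _ _ _ _ _ wm (walkD _ _ _ _ _ wn
    (walk_sym _ _ _ (walk1 _ _ exy)))).
  by rewrite !oddD /=; case: (odd m) (odd n) => -[].
have [m wm] := rP x; have [n wn] := rP y.
have par z k : walk z (r z) k -> `[< exists2 n, odd n & walk z (r z) n >] = odd k.
  move=> wk; apply/asboolP/idP => [[l ol wl]|ok]; last by exists k.
  have := even_closed _ _ (walkD _ _ _ _ _ wl (walk_sym _ _ _ wk)).
  by rewrite oddD ol negbK.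
by rewrite (par _ _ wm) (par _ _ wn); apply: odd_cl.
Qed.

(** * Odd cycles of the integer skip graph *)

Definition int_skip_graph (a b c : int) : rel int :=
  fun u v => `[< exists2 s, s \in [:: a; b; c] & int_adj s u v >].

(** Indexing modulo the size turns a cycle into the periodic walk that [odd_walk_triangle]
    expects. *)
Lemma cycle_nth (T : Type) (x0 : T) (e : rel T) (p : seq T) (i : nat) :
  cycle e p -> 0 < size p ->
  e (nth x0 p (i %% size p)) (nth x0 p (i.+1 %% size p)).
Proof.
move=> cp p0; rewrite -[i.+1]addn1 -modnDml addn1.
have := ltn_pmod i p0; move: (i %% size p) => {}i lti.
move: cp; rewrite (cycle_path x0) => /(pathP x0) h.
move: (lti); rewrite leq_eqVlt => /orP[/eqP e1|lt1].
- by rewrite e1 modnn; have := h 0 p0; rewrite /= -nth_last -e1.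
- by rewrite modn_small //; apply: (h i.+1).
Qed.

Lemma odd_cycle_triangle (a b c : int) (p : seq int) :
  (0 < a)%R -> (0 < b)%R -> (a < c)%R -> (b < c)%R -> a <> b ->
  ucycle (int_skip_graph a b c) p -> odd (size p) ->
  [/\ (a + b = c)%R, opposite_ratio_parity a b & size p = 3].
Proof.
wlog ab : a b / (a < b)%R => [hw|].
  move=> a0 b0 ac bc nab; have [ab|ba] := ltP a b; first exact: hw.
  have lt_ba : (b < a)%R by lia.
  have nba : b <> a by move/esym.
  have e2 : int_skip_graph a b c =2 int_skip_graph b a c.
    move=> u v; apply/asboolP/asboolP => -[s sS h]; exists s => //;
      by move: sS; rewrite !inE orbCA.
  rewrite /ucycle (eq_cycle e2) => up op.
  have [e [g [x [y [i [g0 ex ey exy]]]]] sp] := hw b a lt_ba b0 a0 bc ac nba up op.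
  by split=> //; [rewrite addrC|exists g, y, x, i; split=> //; rewrite addrC].
move=> a0 b0 ac bc _ /andP[cp up] op.
have p0 : 0 < size p by case: (p) op.
have adj i := asboolW (@cycle_nth _ 0%R _ p i cp p0).
have p3 : 2 < size p.
  case: p cp op {up p0 adj} => [|x [|y [|z p]]] //=; rewrite andbT => /asboolP[s sS].
  have s0 : (0 < s)%R by move: sS; rewrite !inE => /or3P[] /eqP ->; lia.
  by move=> /(int_adj_dist s0); lia.
have inj i j : nth 0%R p (i %% size p) = nth 0%R p (j %% size p) -> i = j %[mod size p].
  by move=> /eqP; rewrite nth_uniq ?ltn_pmod // => /eqP.
have [|i|i|e h [i ei]] := @odd_walk_triangle a b c (fun i => nth 0%R p (i %% size p))
  (size p) a0 ab bc op.
- by move=> i; rewrite modnDr.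
- rewrite -addn2 => /inj/eqP; rewrite -[X in _ == X %[mod _]]addn0 eqn_modDl.
  by rewrite mod0n modn_small.
- exact: adj.
(* The return after three steps makes [size p], which is at least 3, divide 3. *)
split=> //; move: ei; rewrite -addn3 => /inj/eqP.
rewrite -[X in _ == X %[mod _]]addn0 eqn_modDl mod0n.
by case: (ltngtP (size p) 3) p3 => // lt3 _; rewrite modn_small.
Qed.

(** * 2-adic valuations and parities of reduced ratios *)

Lemma logn2_eq0 (n : nat) : 0 < n -> (logn 2 n == 0) = odd n.
Proof. by move=> n0; rewrite lognE n0 dvdn2 /=; case: odd. Qed.

Lemma opposite_ratio_parity_logn (a b : nat) : 0 < a -> 0 < b ->
  opposite_ratio_parity a%:Z%R b%:Z%R -> logn 2 a <> logn 2 b.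
Proof.
move=> a0 b0 [g [x [y [i [g0 ea eb exy]]]]].
have x0 : (0 < x)%R by rewrite -(pmulr_rgt0 _ g0) -ea.
have y0 : (0 < y)%R by rewrite -(pmulr_rgt0 _ g0) -eb.
case: g g0 ea eb => // g g0 ea eb; case: x x0 ea exy => // x x0 ea exy.
case: y y0 eb exy => // y y0 eb exy.
have -> : a = g * x by lia.
have -> : b = g * y by lia.
rewrite !lognM //; move/addnI.
have : odd (x + y) by lia.
by rewrite oddD -!logn2_eq0 //; case: (logn 2 x) (logn 2 y) => [|n] [|m].
Qed.

Lemma coprime_ratio_parity (a b : nat) : 0 < a -> 0 < b -> logn 2 a <> logn 2 b ->
  exists g x y : nat, [/\ a = g * x, b = g * y, 0 < g, coprime x y & odd (x + y)].
Proof.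
move=> a0 b0; have g0 : 0 < gcdn a b by rewrite gcdn_gt0 a0.
have [g [x [y [ea eb {}g0 cxy]]]] :
    exists g x y, [/\ a = g * x, b = g * y, 0 < g & coprime x y].
  exists (gcdn a b), (a %/ gcdn a b), (b %/ gcdn a b).
  rewrite ![gcdn a b * _]mulnC !divnK ?dvdn_gcdl ?dvdn_gcdr //; split=> //.
  by rewrite /coprime -(eqn_pmul2r g0) mul1n muln_gcdl !divnK ?dvdn_gcdl ?dvdn_gcdr.
move: a0 b0; rewrite {}ea {}eb !muln_gt0 g0 /= => x0 y0.
rewrite !lognM // => nxy; exists g, x, y; split=> //.
rewrite oddD; apply/negP => /negP; case ox: (odd x); case oy: (odd y) => //= _.
- by move: ox oy; rewrite -!logn2_eq0 // => /eqP ox /eqP oy; apply: nxy; rewrite ox oy.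
- have : 2 %| gcdn x y by rewrite dvdn_gcd !dvdn2 ox oy.
  by rewrite (eqP cxy).
Qed.

(** * Construction of triangles *)

(** All arcs point up, from [u] to [v = u + x] to [w = v + y]. Since [v] is a multiple of the
    coprime [x] and [y], it is [x * y * m]; [u] is a multiple of [x + y] once [y * m] is 1 modulo
    [x + y]. Then [x] even and [y], [m] odd give every multiple the parity it needs. *)
Lemma triangle_coprime (x y : int) : coprimez x y -> (exists i, x = 2 * i)%R ->
  (exists i, y = 2 * i + 1)%R ->
  exists u v w, [/\ int_adj x u v, int_adj y v w & int_adj (x + y)%R u w].
Proof.
move=> /coprimezP[[s t] /= st] [i ei] [j ej].
(* [m] is an odd inverse of [y] modulo [x + y]. *)
have [m [Q [h [em eh]]]] : exists m Q h, (y * m = 1 + Q * (x + y) /\ m = 2 * h + 1)%R.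
  (* Bezout gives the inverse [t - s]; if it is even, adding the odd number [x + y] corrects it. *)
  have [h [eh|eh]] : exists h, (t - s = 2 * h \/ t - s = 2 * h + 1)%R.
    by exists ((t - s) %/ 2)%Z; lia.
  - exists (t - s + (x + y))%R, (y - s)%R, (h + i + j)%R; split; last lia.
    by rewrite -st; ring.
  - exists (t - s)%R, (- s)%R, h; split; last lia.
    by rewrite -st; ring.
exists (x * Q * (x + y))%R, (x * y * m)%R, (x * y * m + y)%R.
have e1 : (x * y * m = x + x * Q * (x + y))%R by rewrite -mulrA em; ring.
split; left.
- exists (j * m + h)%R; split.
    have -> : (x * Q * (x + y) = x * (y * m) - x)%R by rewrite em; ring.
    by rewrite eh ej; ring.
  by rewrite eh ej; ring.
- by exists (i * m)%R; split; rewrite ei; ring.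
- by exists (i * Q)%R; split; [|rewrite e1]; rewrite ei; ring.
Qed.

Lemma int_adj_shift s t u v : int_adj s u v -> int_adj s (u + 2 * t * s)%R (v + 2 * t * s)%R.
Proof.
by case=> -[j [-> ->]]; [left|right]; exists (j + t)%R; split; ring.
Qed.

(** The translation is kept in the statement because the triangle is needed among the negative
    integers for forcing, and among the natural numbers for the 3-cycle. *)
Lemma triangle_exists (a b : nat) : 0 < a -> 0 < b -> logn 2 a <> logn 2 b ->
  exists u v w : int, forall t : int, let k := (2 * t * (a * b * (a + b))%N%:Z)%R in
  [/\ int_adj a (u + k)%R (v + k)%R, int_adj b (v + k)%R (w + k)%R
    & int_adj (a + b)%N (u + k)%R (w + k)%R].
Proof.
move=> a0 b0 nab.
suff [u [v [w [h1 h2 h3]]]] :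
    exists u v w, [/\ int_adj a u v, int_adj b v w & int_adj (a + b)%N u w].
  exists u, v, w => t k.
  have -> : k = (2 * (t * (b * (a + b))%N) * a)%R by rewrite /k; lia.
  split; first exact: int_adj_shift.
  - have -> : (2 * (t * (b * (a + b))%N) * a = 2 * (t * (a * (a + b))%N) * b :> int)%R by lia.
    exact: int_adj_shift.
  - have -> : (2 * (t * (b * (a + b))%N) * a = 2 * (t * (a * b)%N) * (a + b)%N :> int)%R by lia.
    exact: int_adj_shift.
have [g [x [y [-> -> g0 cxy oxy]]]] := coprime_ratio_parity a0 b0 nab.
suff [u [v [w [h1 h2 h3]]]] :
    exists u v w, [/\ int_adj x u v, int_adj y v w & int_adj (x%:Z + y%:Z)%R u w].
  have gn0 : (g%:Z != 0)%R by lia.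
  exists (g%:Z * u)%R, (g%:Z * v)%R, (g%:Z * w)%R.
  by rewrite -mulnDr !PoszM; split; apply/int_adj_scale.
have ev n : ~~ odd n -> exists i, (n%:Z = 2 * i)%R by exists (n./2)%:Z%R; lia.
have od n : odd n -> exists i, (n%:Z = 2 * i + 1)%R by exists (n./2)%:Z%R; lia.
(* [triangle_coprime] wants the even length first; if that is [y], the triangle is traversed
   backwards. *)
have [ox|nox] := boolP (odd x).
- have noy : ~~ odd y by move: oxy; rewrite oddD ox.
  have [|||u [v [w [h1 h2 h3]]]] := @triangle_coprime y x;
    [by rewrite coprimezE coprime_sym|exact: ev|exact: od|].
  exists w, v, u; split; [exact: int_adj_sym|exact: int_adj_sym|].
  by rewrite addrC; apply: int_adj_sym.
- have oy : odd y by move: oxy; rewrite oddD (negbTE nox).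
  by apply: triangle_coprime; [rewrite coprimezE|exact: ev|exact: od].
Qed.

(** * Discrepancy at most one, and the passage to the integers *)

Lemma sum_even_pairs (y : nat -> int) (j : nat) :
  (forall i, i < j -> y (2 * i + 2) = (- y (2 * i + 1)%N)%R) ->
  (\sum_(1 <= i < (2 * j).+1) y i = 0)%R.
Proof.
elim: j => [|j IH] h; first by rewrite big_nil.
have -> : 2 * j.+1 = (2 * j).+2 by lia.
rewrite big_nat_recr // big_nat_recr //= IH ?add0r; last by move=> i ij; apply: h; lia.
by have := h j (ltnSn j); rewrite addn2 addn1 => ->; rewrite subrr.
Qed.

(** By induction the partial sums of even length vanish; two equal terms after one of them would
    give 2 or -2. *)
Lemma sums_le1P (y : nat -> int) :
  (forall n, 0 < n -> y n = 1%R \/ y n = (-1)%R) ->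
  (forall k, 0 < k -> (`|\sum_(1 <= i < k.+1) y i| <= 1)%R) <->
  (forall j, y (2 * j + 2) = (- y (2 * j + 1)%N)%R).
Proof.
move=> y1; split=> [h j|h k _].
- elim/ltn_ind: j => j /sum_even_pairs e.
  have := h (2 * j).+2 isT; rewrite big_nat_recr // big_nat_recr //= e add0r addn2 addn1.
  have := y1 (2 * j).+1 isT; have := y1 (2 * j).+2 isT; lia.
- have e := @sum_even_pairs y k./2 (fun i _ => h i).
  rewrite -(odd_double_half k) -mul2n; case: (odd k); rewrite ?add0n ?add1n ?e //.
  by rewrite big_nat_recr //= e add0r; have := y1 (2 * k./2).+1 isT; lia.
Qed.

Lemma skip_arcE (s u v : nat) : 0 < s ->
  skip_arc s u v <-> int_arc s%:Z%R u%:Z%R v%:Z%R.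
Proof.
move=> s0; split=> [[j [-> ->]]|[[j|j] [e1 e2]]].
- by exists j; lia.
- by exists j; split; lia.
- by exfalso; move: e1; nia.
Qed.

Lemma skip_graphE (a b c u v : nat) : 0 < a -> 0 < b -> 0 < c ->
  skip_graph [fset a; b; c]%fset u v = int_skip_graph a%:Z%R b%:Z%R c%:Z%R u%:Z%R v%:Z%R.
Proof.
move=> a0 b0 c0; apply/asboolP/asboolP => -[s].
- rewrite !inE -orbA => sS h; exists s%:Z%R; first by rewrite !inE !eqz_nat.
  have s0 : 0 < s by case/or3P: sS => /eqP ->.
  by case: h => /skip_arcE-/(_ s0) h; [left|right].
- case: s => [s|s]; rewrite !inE ?orbF // !eqz_nat => sS h.
  have s0 : 0 < s by case/or3P: sS => /eqP ->.
  exists s; first by rewrite !inE -orbA.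
  by case: h => /skip_arcE-/(_ s0) h; [left|right].
Qed.

Lemma int_skip_graph_sym (a b c : int) : symmetric (int_skip_graph a b c).
Proof. by move=> u v; apply/asboolP/asboolP => -[s sS /int_adj_sym h]; exists s. Qed.

Lemma int_arc_opp (s j : nat) :
  int_arc s%:Z%R (- ((2 * j + 2) * s)%N%:Z)%R (- ((2 * j + 1) * s)%N%:Z)%R.
Proof. by exists (- (j.+1)%:Z)%R; lia. Qed.

(** A sequence of discrepancy at most one, read at absolute values, properly 2-colours the negative
    vertices, which a triangle among them prevents. *)
Lemma forces_of_triangle (S : {fset nat}) (a b c : nat) (u v w : int) :
  0 < a -> 0 < b -> 0 < c -> a \in S -> b \in S -> c \in S ->
  (u < 0)%R -> (v < 0)%R -> (w < 0)%R ->
  int_adj a u v -> int_adj b v w -> int_adj c u w -> forces_discrepancy_two S.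
Proof.
move=> a0 b0 c0 aS bS cS u0 v0 w0 uv vw uw x x1; apply: contrapT => nf.
have pair s y z : 0 < s -> s \in S -> (y < 0)%R -> (z < 0)%R -> int_arc s y z ->
    x `|y|%N = (- x `|z|%N)%R.
  move=> s0 sS y0 z0 [i [ey ez]].
  have [j ej] : exists j : nat, i = (- (j.+1)%:Z)%R.
    by exists (`|i|.-1); move: y0; rewrite ey; nia.
  have y1 n : 0 < n -> (x (n * s) = 1 \/ x (n * s) = -1)%R.
    by move=> n0; apply: x1; rewrite muln_gt0 n0.
  have /(sums_le1P y1)/(_ j) : forall k, 0 < k ->
      (`|\sum_(1 <= i < k.+1) x (i * s)%N| <= 1)%R.
    by move=> k k0; rewrite leNgt; apply/negP => lt; apply: nf; exists s, k.
  suff [-> ->] : `|y|%N = (2 * j + 2) * s /\ `|z|%N = (2 * j + 1) * s by [].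
  by rewrite ey ez ej; lia.
have adj s y z : 0 < s -> s \in S -> (y < 0)%R -> (z < 0)%R -> int_adj s y z ->
    x `|y|%N = (- x `|z|%N)%R.
  move=> s0 sS y0 z0 [h|h]; first exact: (pair s).
  by rewrite (pair s z y) // opprK.
have := adj a u v a0 aS u0 v0 uv; have := adj b v w b0 bS v0 w0 vw.
have := adj c u w c0 cS u0 w0 uw; have := x1 `|w|%N; lia.
Qed.

(** The term at [n] is the colour of [-n], so the two terms of each pair have opposite signs. *)
Lemma not_forces_of_bipartite (a b c : nat) (f : int -> bool) :
  (forall u v, int_skip_graph a b c u v -> f v = ~~ f u) ->
  ~ forces_discrepancy_two [fset a; b; c]%fset.
Proof.
move=> fP /(_ (fun n => if f (- n%:Z)%R then 1 else -1)%R) [n _|s [k [sS k0]]].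
  by case: (f _); [left|right].
have : (`|\sum_(1 <= i < k.+1) (if f (- (i * s)%N%:Z) then 1 else -1) : int| <= 1)%R.
  move: k k0; apply/(sums_le1P (y := fun i => if f (- (i * s)%N%:Z)%R then 1%R else (-1)%R)).
    by move=> n _; case: (f _); [left|right].
  move=> j; rewrite (fP (- ((2 * j + 2) * s)%N%:Z)%R (- ((2 * j + 1) * s)%N%:Z)%R).
    by case: (f _); rewrite /= ?opprK.
  apply/asboolP; exists s%:Z%R; last by left; exact: int_arc_opp.
  by move: sS; rewrite !inE !eqz_nat -orbA.
by rewrite leNgt => /negP.
Qed.

(** * The equivalence and the odd cycles *)

Theorem theorem2 (a b c : nat) (S : {fset nat})
    (a_gt0 : 0 < a) (b_gt0 : 0 < b) (c_gt0 : 0 < c)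
    (distinct_abc : uniq [:: a; b; c]) (lt_ac : a < c) (lt_bc : b < c)
    (def_S : S = [fset a; b; c]%fset) :
  (forces_discrepancy_two S <-> a + b = c /\ logn 2 a <> logn 2 b)
  /\ (a + b = c /\ logn 2 a <> logn 2 b ->
      (exists p : seq nat, graph_cycle (skip_graph S) p /\ size p = 3)
      /\ (forall p : seq nat,
            graph_cycle (skip_graph S) p -> odd (size p) -> size p = 3)).
Proof.
subst S.
have key p : ucycle (int_skip_graph a b c) p -> odd (size p) ->
    [/\ a + b = c, logn 2 a <> logn 2 b & size p = 3].
  move=> up op; have [|||||eabc par sp] := odd_cycle_triangle _ _ _ _ _ up op; try lia.
    by move: distinct_abc; rewrite /= !inE; lia.
  by split=> //; [lia|apply: opposite_ratio_parity_logn].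
have N0 : 0 < a * b * (a + b) by rewrite !muln_gt0 addn_gt0 a_gt0 b_gt0.
split; first split.
- move=> forces; apply: contrapT => ncond.
  have [|f fP] := bipartite_of_no_odd_cycle (int_skip_graph_sym a b c).
    by move=> p up; apply/negP => /(key p up)[e n _]; apply: ncond.
  exact: not_forces_of_bipartite fP forces.
- case=> eabc nlog; have [u [v [w tri]]] := triangle_exists a_gt0 b_gt0 nlog.
  (* As [a * b * (a + b)] is positive and [t] negative, [k] is at most [t], and the translated
     vertices are negative. *)
  pose t : int := (- (`|u| + `|v| + `|w| + 1))%R.
  have := tri t; set k := (2 * t * _)%R; rewrite eabc -/k => -[uv vw uw].
  have kt : (k <= t)%R.
    have t0 : (t < 0)%R by rewrite /t; lia.
    by rewrite /k; move: t0; clear -N0; nia.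
  apply: (forces_of_triangle a_gt0 b_gt0 c_gt0 _ _ _ _ _ _ uv vw uw);
    by rewrite ?inE ?eqxx ?orbT //; lia.
- case=> eabc nlog; have [u [v [w tri]]] := triangle_exists a_gt0 b_gt0 nlog; split.
    (* The opposite translation puts the triangle in the natural numbers; the distances along its
       arcs keep its vertices distinct. *)
    pose t : int := (`|u| + `|v| + `|w| + 1)%R.
    have := tri t; set k := (2 * t * _)%R; rewrite eabc -/k => -[uv vw uw].
    have kt : (t <= k)%R.
      have t0 : (0 < t)%R by rewrite /t; lia.
      by rewrite /k; move: t0; clear -N0; nia.
    have [u' eu] : exists n : nat, (u + k)%R = n by exists `|(u + k)%R|%N; lia.
    have [v' ev] : exists n : nat, (v + k)%R = n by exists `|(v + k)%R|%N; lia.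
    have [w' ew] : exists n : nat, (w + k)%R = n by exists `|(w + k)%R|%N; lia.
    rewrite eu ev ew in uv vw uw.
    have duv := int_adj_dist _ uv; have dvw := int_adj_dist _ vw; have duw := int_adj_dist _ uw.
    exists [:: u'; v'; w']; split=> //; split=> //.
    apply/andP; split; last by rewrite /= !inE; lia.
    rewrite /= !skip_graphE // andbT; apply/and3P; split; apply/asboolP.
    + by exists a%:Z%R => //; rewrite !inE eqxx.
    + by exists b%:Z%R => //; rewrite !inE eqxx orbT.
    + by exists c%:Z%R; rewrite ?inE ?eqxx ?orbT //; apply: int_adj_sym.
- move=> p [/andP[cp up] _]; rewrite -(size_map Posz) => op.
  have [|//] := key (map Posz p) _ op.
  rewrite /ucycle cycle_map map_inj_uniq ?up ?andbT; last by move=> ? ? [].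
  by rewrite -(eq_cycle (e := skip_graph [fset a; b; c]%fset)) // => x y; rewrite skip_graphE.
Qed.
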